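(* (First Separation Theorem) Let $\mathbf P=(P,\leq,{}',0,1)$ be a complemented poset with antitone complementation satisfying $x\leq x''$ for each $x\in P$. Let $I$ be an ideal of $\mathbf P$ and let $F$ be a filter of $\mathbf P$ such that $F$ satisfies the c-condition and $I\cap F=\emptyset$. Then there exists some c-ideal $J$ of $\mathbf P$ with $I\subseteq J$ and $J\cap F=\emptyset$.
   Context: For a poset $(P,\leq)$ and $A\subseteq P$ put $L(A)=\{x\in P\mid x\leq y\text{ for all }y\in A\}$ and $U(A)=\{x\in P\mid y\leq x\text{ for all }y\in A\}$; write $L(a)=L(\{a\})$, $L(a,b)=L(\{a,b\})$, and similarly for $U$. A complemented poset $\mathbf P=(P,\leq,{}',0,1)$ is a bounded poset (bottom $0$, top $1$) with a unary operation ${}'$ (the complementation) such that for every $x\in P$ the join $x\vee x'$ and the meet $x\wedge x'$ exist and $x\vee x'=1$, $x\wedge x'=0$. The operation ${}'$ is antitone if $x\leq y$ implies $y'\leq x'$. Write $x''=(x')'$. For $A\subseteq P$ put $A_0=\{x\in P\mid x'\in A\}$. A non-empty subset $I$ of $P$ is an ideal of $\mathbf P$ if $L(x)\subseteq I$ and $U(x,y)\cap I\neq\emptyset$ for all $x,y\in I$. A non-empty subset $F$ of $P$ is a filter of $\mathbf P$ if $U(x)\subseteq F$ and $L(x,y)\cap F\neq\emptyset$ for all $x,y\in F$. An ideal $J$ of $\mathbf P$ is a c-ideal if there exists some filter $G$ of $\mathbf P$ with $G_0=J$. A subset $A$ of $P$ satisfies the c-condition if for every $x\in P$ the set $A$ contains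 exactly one of $x$ and $x'$. *)

(* Defs.v *)
From mathcomp Require Import all_boot all_order.
From mathcomp Require Import boolp classical_sets.

Set Implicit Arguments.
Unset Strict Implicit.
Unset Printing Implicit Defensive.

Local Open Scope classical_set_scope.

Section ComplementedPoset.
Context {d : Order.disp_t} {P : tbPOrderType d}.

(* For a set A of elements of P, lbound A is L(A) and ubound A is U(A).
   In a poset, supremums A and infimums A have at most one element, so
   supremums A s says that the join of A exists and equals s (dually for
   meets). *)

Definition is_complementation (c : P -> P) :=
  forall x, supremums [set x; c x] (\top)%O /\ infimums [set x; c x] (\bot)%O.

Definition is_ideal (I : set P) :=
  I !=set0 /\
  forall x y, I x -> I y ->
    lbound [set x] `<=` I /\ ubound [set x; y] `&` I !=set0.

Definition is_filter (F : set P) :=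
  F !=set0 /\
  forall x y, F x -> F y ->
    ubound [set x] `<=` F /\ lbound [set x; y] `&` F !=set0.

(* The preimage c @^-1` G is the set G_0 of all x such that c x is in G. *)
Definition is_c_ideal (c : P -> P) (J : set P) :=
  is_ideal J /\ exists2 G : set P, is_filter G & c @^-1` G = J.

Definition c_condition (c : P -> P) (A : set P) :=
  forall x, (A x /\ ~ A (c x)) \/ (~ A x /\ A (c x)).

End ComplementedPoset.

(* Main.v *)
Require Import Defs.
From mathcomp Require Import all_boot all_order.
From mathcomp Require Import boolp classical_sets.

(** The c-ideal is [J = F_0], the set of all [x] with [c x] in [F].  By the
    c-condition, [x] belongs to [F_0] exactly when it does not belong to [F];
    so [F_0] is the complement of [F], which is disjoint from [F] and contains
    every set disjoint from [F], in particular [I].  That [F_0] is an ideal holds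
    for every filter [F] ([filter_preimage_ideal]): antitonicity makes [F_0] a
    down-set, and [x <= c (c x)] turns a lower bound in [F] of [c x] and [c y]
    into an upper bound in [F_0] of [x] and [y]. *)

Import Order.Theory.
Local Open Scope classical_set_scope.

Lemma filter_upward (d : Order.disp_t) (P : tbPOrderType d) (G : set P)
    (x y : P) :
  is_filter G -> (x <= y)%O -> G x -> G y.
Proof.
move=> [_ hG] le_xy Gx; have [upG _] := hG x x Gx Gx.
by apply: upG => _ ->.
Qed.

Lemma filter_preimage_ideal (d : Order.disp_t) (P : tbPOrderType d)
    (c : P -> P) (G : set P) :
  (forall x y : P, (x <= y)%O -> (c y <= c x)%O) ->
  (forall x : P, (x <= c (c x))%O) ->
  is_filter G -> is_ideal (c @^-1` G).
Proof.
move=> anti le_cc hG; have [[g Gg] dirG] := hG.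
have cP z : G z -> (c @^-1` G) (c z) by exact: filter_upward hG (le_cc z).
split; first by exists (c g); apply: cP.
move=> x y /= Gcx Gcy; split.
  by move=> z /(_ x erefl) le_zx; apply: filter_upward hG (anti _ _ le_zx) Gcx.
have [_ [z [lb_z Gz]]] := dirG _ _ Gcx Gcy.
have le_z t : (z <= c t)%O -> (t <= c z)%O.
  by move=> /anti; apply: le_trans.
exists (c z); split; last exact: cP.
by move=> t [->|->]; apply: le_z; apply: lb_z; [left|right].
Qed.

Lemma c_condition_preimage (d : Order.disp_t) (P : tbPOrderType d)
    (c : P -> P) (A : set P) :
  c_condition c A -> c @^-1` A = ~` A.
Proof.
by move=> hA; apply/seteqP; split=> x /=; case: (hA x) => -[].
Qed.

Theorem theorem16 (d : Order.disp_t) (P : tbPOrderType d) (c : P -> P)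
    (hc : is_complementation c)
    (hanti : forall x y : P, (x <= y)%O -> (c y <= c x)%O)
    (hcc : forall x : P, (x <= c (c x))%O)
    (I F : set P) (hI : is_ideal I) (hF : is_filter F)
    (hFc : c_condition c F) (hIF : I `&` F = set0) :
  exists J : set P, [/\ is_c_ideal c J, I `<=` J & J `&` F = set0].
Proof.
exists (c @^-1` F); split.
- by split; [exact: filter_preimage_ideal|exists F].
- by rewrite c_condition_preimage // -disjoints_subset.
- by rewrite c_condition_preimage // setICl.
Qed.
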